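(* There is a constant $c>0$ such that for every sufficiently large $n$ for which $\sqrt{n}$ is an odd integer, every deterministic $\mathsf{Online}$-$\mathsf{LOCAL}$ algorithm that properly 3-colors every $(\sqrt{n}\times\sqrt{n})$ toroidal grid has locality at least $c\sqrt{n}$, and the same holds for $(\sqrt{n}\times\sqrt{n})$ cylindrical grids. That is, the locality of 3-coloring $(\sqrt{n}\times\sqrt{n})$ toroidal and cylindrical grids in $\mathsf{Online}$-$\mathsf{LOCAL}$ is $\Omega(\sqrt{n})$.
   Context: For a graph $G=(V,E)$, $U\subseteq V$ and an integer $T\ge 0$, $\mathcal{B}(U,T)$ denotes the set of nodes at distance at most $T$ from some node of $U$, and $G[U]$ denotes the induced subgraph. The $\mathsf{Online}$-$\mathsf{LOCAL}$ model: an algorithm with locality $T=T(n)$ is deterministic and knows $n$. The adversary chooses an $n$-node input graph $G=(V,E)$ from the input family, assigns distinct identifiers from $\{1,\dots,\mathrm{poly}(n)\}$ to its nodes, and chooses an ordering $\sigma=(v_1,\dots,v_n)$ of $V$. For $i=1,\dots,n$, when $v_i$ is presented, the algorithm must irrevocably assign an output (here a color) to $v_i$ as a function of the sequence $(v_1,\dots,v_i)$ and the induced subgraph $G_i=G\big[\bigcup_{j\le i}\mathcal{B}(v_j,T)\big]$ (with identifiers); thus the algorithm has global memory of everything seen so far. The algorithm solves a coloring problem on an input family if for every choice of the adversary the final coloring is proper and uses only the allowed colors. The locality of a problem is the minimum locality of an algorithm solving it. An $(a\times b)$ simple grid has node set $\{(i,j): i\in[a], j\in[b]\}$, with $(i,j)$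 and $(i',j')$ adjacent iff $|i-i'|+|j-j'|=1$. An $(a\times b)$ cylindrical grid is obtained from it by adding the edges $\{(i,1),(i,b)\}$ for all $i\in[a]$. An $(a\times b)$ toroidal grid is obtained from the cylindrical grid by further adding the edges $\{(1,j),(a,j)\}$ for all $j\in[b]$. *)

(* Defs.v *)
From mathcomp Require Import all_boot all_order all_algebra.
Set Implicit Arguments. Unset Strict Implicit. Unset Printing Implicit Defensive.

Definition nbh (V : finType) (e : rel V) (A : {set V}) : {set V} :=
  A :|: [set v | [exists u in A, e u v]].

Definition ball (V : finType) (e : rel V) (T : nat) (U : {set V}) : {set V} :=
  iter T (nbh e) U.

(* A deterministic Online-LOCAL algorithm producing 3 colours.  Its input when
   the i-th node is presented is:
   - the sequence of identifiers of the presented nodes v_1, ..., v_i;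
   - the identifier-labelled induced subgraph G_i, given as the predicate of
     visible identifiers and the adjacency relation between visible identifiers.
   (n is fixed before the algorithm is quantified, so the algorithm knows n.) *)
Definition algo := seq nat -> (nat -> bool) -> (nat -> nat -> bool) -> 'I_3.

Section Run.
Variables (V : finType) (e : rel V) (T : nat) (id : V -> nat) (sigma : seq V).

Definition seen (i : nat) : {set V} := ball e T [set x in take i sigma].

Definition vis_ids (i : nat) : nat -> bool :=
  fun x => [exists v in seen i, id v == x].

Definition adj_ids (i : nat) : nat -> nat -> bool :=
  fun x y => [exists u in seen i, exists w in seen i,
                [&& id u == x, id w == y & e u w]].

Definition online_color (A : algo) (v : V) : 'I_3 :=
  let i := (index v sigma).+1 in
  A (map id (take i sigma)) (vis_ids i) (adj_ids i).
End Run.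

(* A with locality T solves 3-colouring on the (single, up to isomorphism)
   n-node input graph (V,e): for every identifier assignment (distinct, in
   {1,...,n^k}) and every ordering of V, the produced colouring is proper. *)
Definition solves_3col (V : finType) (e : rel V) (n k T : nat) (A : algo) : Prop :=
  forall (id : V -> nat) (sigma : seq V),
    injective id ->
    (forall v, 1 <= id v <= n ^ k) ->
    uniq sigma -> (forall v, v \in sigma) ->
    forall u v, e u v -> online_color e T id sigma A u != online_color e T id sigma A v.

Definition grid_adj (a b : nat) (x y : 'I_a * 'I_b) : bool :=
  let: (i, j) := x in let: (i', j') := y in
  ((i == i' :> nat) && ((j.+1 == j' :> nat) || (j'.+1 == j :> nat)))
  || ((j == j' :> nat) && ((i.+1 == i' :> nat) || (i'.+1 == i :> nat))).

Definition cyl_adj (a b : nat) (x y : 'I_a * 'I_b) : bool :=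
  grid_adj x y ||
  ((x.1 == y.1 :> nat) &&
   (((x.2 == 0 :> nat) && (y.2 == b.-1 :> nat)) ||
    ((y.2 == 0 :> nat) && (x.2 == b.-1 :> nat)))).

Definition torus_adj (a b : nat) (x y : 'I_a * 'I_b) : bool :=
  cyl_adj x y ||
  ((x.2 == y.2 :> nat) &&
   (((x.1 == 0 :> nat) && (y.1 == a.-1 :> nat)) ||
    ((y.1 == 0 :> nat) && (x.1 == a.-1 :> nat)))).

(* Main.v *)
(** Give a properly 3-coloured edge (a, b) the sign +1 if b = a + 1 mod 3 and -1
    otherwise.  Signs sum to 0 around every 4-cycle, so going once around a row
    of the cylinder gives the same sum (the winding number) for all rows; for
    odd m it is odd, hence nonzero.  Present first all the nodes of two rows
    whose T-neighbourhoods are disjoint bands.  What the algorithm sees does not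
    tell it how the two bands are oriented relative to each other, so it colours
    the two rows in the same way on the instance in which the second band is
    reflected.  There the winding number of the second row changes sign while
    that of the first row does not, although both must be equal. *)
Require Import Defs.
From mathcomp Require Import all_boot all_order all_algebra.
From mathcomp Require Import zify.
From Stdlib Require Import FunctionalExtensionality.
Import GRing.Theory Num.Theory.

Set Implicit Arguments. Unset Strict Implicit. Unset Printing Implicit Defensive.

(** * Runs of an online algorithm under a renaming of the nodes *)

Section OnlineRun.

Variables (V : finType) (T : nat) (A : algo).
Implicit Types (e : rel V) (U : {set V}) (f : V -> V).

Lemma ballS e t U : ball e t.+1 U = nbh e (ball e t U).
Proof. by []. Qed.

(** A ball grows only along edges leaving nodes already reached, so as long as it stays in [W],
    edges starting outside [W] do not influence it. *)
Lemma ball_eq_in e e' (W : {set V}) U :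
    {in W, forall u, e u =1 e' u} ->
    (forall t, t <= T -> ball e t U \subset W) ->
  ball e' T U = ball e T U.
Proof.
move=> ee' UW; elim: {-2}T (leqnn T) => // t IHt ltT.
rewrite !ballS IHt 1?ltnW // /nbh; congr (_ :|: _).
apply/setP=> v; rewrite !inE; apply: eq_existsb => u.
by apply: andb_id2l => /(subsetP (UW t (ltnW ltT)))/ee' ->.
Qed.

Lemma ball_conj e f U : involutive f ->
  ball e T (f @: U) = f @: ball (fun u v => e (f u) (f v)) T U.
Proof.
move=> fK; elim: T => // t IHt; rewrite !ballS IHt /nbh.
set B := ball _ t U.
apply/setP=> v; rewrite -(fK v); move: (f v) => {}v.
rewrite (mem_imset _ _ (inv_inj fK)) !inE (mem_imset _ _ (inv_inj fK)).
congr (_ || _); apply/existsP/existsP => -[u /andP[uB euv]]; exists (f u).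
  by rewrite -(mem_imset _ _ (inv_inj fK)) fK uB.
by rewrite (mem_imset _ _ (inv_inj fK)) uB.
Qed.

(* Renaming the nodes by [f] on an instance is the same as conjugating its edge
   relation, and the algorithm cannot see a change of the edges outside [W]. *)
Lemma online_color_conj e f (W : {set V}) (id : V -> nat) (sigma : seq V) v :
    involutive f ->
    {in W, forall u, e u =1 (fun w => e (f u) (f w))} ->
    (forall t, t <= T ->
       ball e t [set x in take (index v sigma).+1 sigma] \subset W) ->
  online_color e T (id \o f) (map f sigma) A (f v) = online_color e T id sigma A v.
Proof.
move=> fK eW UW; have finj := inv_inj fK.
rewrite /online_color (index_map finj) -map_take.
set i := (index v sigma).+1.
have seenE : seen e T (map f sigma) i = f @: seen e T sigma i.
  rewrite /seen -(ball_eq_in eW UW) -ball_conj //; congr (ball e T _).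
  apply/setP=> x; rewrite -(fK x) (mem_imset _ _ finj) !inE.
  by rewrite -map_take (mem_map finj).
congr (A _ _ _).
- by rewrite -map_comp; apply: eq_map => x /=; rewrite fK.
- apply: functional_extensionality => x; rewrite /vis_ids seenE.
  apply/existsP/existsP => -[u /andP[us idu]]; exists (f u).
    by rewrite -(mem_imset _ _ finj) fK us.
  by rewrite (mem_imset _ _ finj) us /= fK.
- apply: functional_extensionality => x; apply: functional_extensionality => y.
  rewrite /adj_ids seenE.
  have sW u : u \in seen e T sigma i -> u \in W by apply: (subsetP (UW T _)).
  apply/existsP/existsP => -[u /andP[us /existsP[w /and4P[ws idu idw euw]]]];
    exists (f u).
    have us' : f u \in seen e T sigma i by rewrite -(mem_imset _ _ finj) fK.
    rewrite us'; apply/existsP; exists (f w).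
    rewrite -(mem_imset _ _ finj) fK ws -/(comp id f u) -/(comp id f w) idu idw.
    by rewrite /= (eW _ (sW _ us')) !fK.
  rewrite (mem_imset _ _ finj) us; apply/existsP; exists (f w).
  by rewrite (mem_imset _ _ finj) ws /= !fK idu idw -(eW _ (sW _ us)).
Qed.

End OnlineRun.

(** * Signs and winding numbers of colourings of a cycle *)

Section Winding.

Local Open Scope ring_scope.

(** The value 0 on equal colours keeps the sign antisymmetric without assuming properness. *)
Definition edge_sign (a b : 'I_3) : int :=
  if a == b then 0 else if b == ordS a then 1 else -1.

Lemma edge_signC a b : edge_sign b a = - edge_sign a b.
Proof. by case: a b => [[|[|[|//]]] ?] [[|[|[|//]]] ?]. Qed.

(** Around the 4-cycle the signs sum to a multiple of 3 that is even and at most 4 in absolute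
    value, hence to 0. *)
Lemma edge_sign_square a b c d : a != b -> c != d -> a != c -> b != d ->
  edge_sign a b + edge_sign b d = edge_sign a c + edge_sign c d.
Proof.
by case: a b c d => [[|[|[|//]]] ?] [[|[|[|//]]] ?] [[|[|[|//]]] ?] [[|[|[|//]]] ?].
Qed.

Variable m : nat.

Definition winding (h : 'I_m -> 'I_3) : int := \sum_j edge_sign (h j) (h (ordS j)).

Lemma winding_rev h : winding (h \o @rev_ord m) = - winding h.
Proof.
have rev_ordS (j : 'I_m) : rev_ord (ordS j) = ord_pred (rev_ord j).
  apply/val_inj => /=; have := ltn_ord j => ltj.
  have [lt|ge] := ltnP j.+1 m; first by rewrite modn_small //;
    rewrite (_ : (_ + _).-1 = (m - j.+2) + m)%N ?modnDr ?modn_small; lia.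
  have -> : j.+1 = m by lia.
  by rewrite modnn subnn modn_small; lia.
rewrite /winding (reindex_inj rev_ord_inj) /= (reindex_inj (@ordS_inj m)) /=.
rewrite -sumrN; apply: eq_bigr => j _.
by rewrite (rev_ordS (rev_ord _)) !rev_ordK ordSK edge_signC.
Qed.

(** A sum of [m] terms equal to 1 or -1 has the parity of [m]. *)
Lemma winding_neq0 h : odd m -> (forall j, h j != h (ordS j)) -> winding h != 0.
Proof.
move=> oddm proper_h; apply/eqP => w0.
have signE a b : a != b -> edge_sign a b = 1 - (b != ordS a)%:R *+ 2.
  by case: a b => [[|[|[|//]]] ?] [[|[|[|//]]] ?].
have : winding h = m%:Z - (\sum_j (h (ordS j) != ordS (h j)))%N%:Z *+ 2.
  rewrite /winding (eq_bigr _ (fun j _ => signE _ _ (proper_h j))).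
  by rewrite sumrB sumr_const card_ord sumrMnl -natr_sum !natz.
by rewrite w0; lia.
Qed.

(** Add up the 4-cycle identities of the ladder between the two cycles; the rungs cancel because
    [ordS] permutes the columns. *)
Lemma winding_eq (h h' : 'I_m -> 'I_3) :
    (forall j, h j != h (ordS j)) -> (forall j, h' j != h' (ordS j)) ->
    (forall j, h j != h' j) ->
  winding h = winding h'.
Proof.
move=> Ph Ph' Phh'.
pose s j := edge_sign (h j) (h' j).
have : winding h + \sum_j s (ordS j) = \sum_j s j + winding h'.
  rewrite /winding -!big_split; apply: eq_bigr => j _ /=.
  exact: edge_sign_square.
by rewrite [\sum_j s j](reindex_inj (@ordS_inj m)) /= addrC => /addrI.
Qed.

End Winding.

(** * Reflecting one side of the cylinder *)

Section Cylinder.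

Variable m : nat.
Hypotheses (oddm : odd m) (m_gt1 : 1 < m).
Local Notation node := ('I_m * 'I_m)%type.
Implicit Types (u v : node) (i j : 'I_m).

Lemma cyl_adj_ordS i j : cyl_adj (i, j) (i, ordS j).
Proof.
rewrite /cyl_adj /grid_adj /= eqxx /=; have ltj := ltn_ord j.
have [lt|ge] := ltnP j.+1 m; first by rewrite modn_small // eqxx.
have -> : j.+1 = m :> nat by lia.
by rewrite modnn; lia.
Qed.

Lemma winding_row (f : node -> 'I_3) i i' :
    (forall u v, cyl_adj u v -> f u != f v) ->
  winding (fun j => f (i, j)) = winding (fun j => f (i', j)).
Proof.
move=> Pf; set w := fun i => winding (fun j => f (i, j)).
have w0 k (ltk : k < m) : w (Ordinal ltk) = w (Ordinal (ltnW m_gt1)).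
  elim: k ltk => [|k IHk] ltk; first by congr w; apply: val_inj.
  rewrite -(IHk (ltnW ltk)) /w; apply: winding_eq => j; apply: Pf;
    try exact: cyl_adj_ordS.
  by rewrite /cyl_adj /grid_adj /=; lia.
by rewrite -!/(w _); case: i i' => [k ltk] [k' ltk']; rewrite !w0.
Qed.

Lemma cyl_adj_row u v : cyl_adj u v -> u.1 <= v.1.+1 /\ v.1 <= u.1.+1.
Proof. by case: u v => [i j] [i' j']; rewrite /cyl_adj /grid_adj /=; lia. Qed.

Definition flip (h : nat) u : node := if u.1 < h then u else (u.1, rev_ord u.2).

Lemma flip1 h u : (flip h u).1 = u.1.
Proof. by rewrite /flip; case: ifP. Qed.

Lemma flipK h : involutive (flip h).
Proof.
move=> [i j]; rewrite /flip /=; case: (boolP (i < h)) => [|/negPf] /= lt_i; by rewrite lt_i ?rev_ordK.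
Qed.

Lemma cyl_adj_flip h u v : (u.1 < h) = (v.1 < h) ->
  cyl_adj (flip h u) (flip h v) = cyl_adj u v.
Proof.
rewrite /flip => <-; case: ifP => // _; case: u v => [i j] [i' j'] /=.
by rewrite /cyl_adj /grid_adj /=; have := ltn_ord j; have := ltn_ord j'; lia.
Qed.

(** Extra edges are allowed between nodes of the first and last rows, which covers the cylinder and
    the torus at once. *)
Lemma cyl_like_locality (e : rel node) (T k : nat) (A : algo) :
    subrel (@cyl_adj m m) e ->
    (forall u v, 0 < u.1 < m.-1 -> e u v = cyl_adj u v) ->
    1 <= k -> 4 * T + 6 <= m ->
  ~ solves_3col e (m * m) k T A.
Proof.
move=> sub_e eE k_gt0 leTm solA.
have lt1 : T.+1 < m by lia.
have lt2 : 3 * T + 4 < m by lia.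
pose r1 := Ordinal lt1; pose r2 := Ordinal lt2.
(* [near T] consists of rows 1 to 2T+1 and 2T+4 to 4T+4. It avoids the first and last rows, since
   4T+6 <= m, and leaves two free rows between the bands. *)
pose near t := [set u : node | (T.+1 - t <= u.1 <= T.+1 + t)
                          || (3 * T + 4 - t <= u.1 <= 3 * T + 4 + t)].
pose s0 := enum (near 0); pose sigma := s0 ++ enum (~: near 0).
pose id (u : node) := (enum_rank u).+1.
(* The cut runs between the two free rows, so no edge with an end in a band crosses it. *)
pose f := flip (2 * T + 3).
have sigma_uniq : uniq sigma.
  rewrite cat_uniq !enum_uniq andbT; apply/hasPn => u; rewrite !mem_enum.
  by rewrite inE.
have sigma_full u : u \in sigma.
  by rewrite mem_cat !mem_enum in_setC orbN.
have id_inj : injective id by move=> u v [/val_inj/enum_rank_inj].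
have id_bound u : 1 <= id u <= (m * m) ^ k.
  rewrite /id /=; apply: leq_trans (ltn_ord _) _.
  rewrite card_prod card_ord -{1}(expn1 (m * m)) leq_exp2l //; nia.
have e_flip : {in near T, forall u, e u =1 (fun v => e (f u) (f v))}.
  move=> [i j]; rewrite inE /= => uT v.
  have i_mid : 0 < i < m.-1 by lia.
  rewrite !eE ?flip1 //.
  have [uv|nuv] := boolP ((i < 2 * T + 3) == (v.1 < 2 * T + 3)).
    by rewrite cyl_adj_flip //= (eqP uv).
  by apply/idP/idP => /cyl_adj_row; rewrite ?flip1 /=; lia.
have ball_near (U : {set node}) t :
    U \subset near 0 -> t <= T -> ball e t U \subset near T.
  move=> U0 tT; suff : ball e t U \subset near t.
    by move/subset_trans; apply; apply/subsetP => u; rewrite !inE; lia.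
  elim: t tT => // t IHt tT; have {}IHt := IHt (ltnW tT).
  rewrite ballS; apply/subsetP => v; rewrite in_setU.
  case/orP => [/(subsetP IHt)|]; first by rewrite !inE; lia.
  rewrite inE => /existsP[u /andP[/(subsetP IHt) ut]].
  move: ut; rewrite !inE => ut; rewrite eE; last by lia.
  by move/cyl_adj_row; lia.
have color_f u : u \in near 0 ->
    online_color e T (id \o f) (map f sigma) A (f u)
      = online_color e T id sigma A u.
  move=> u0; apply: (@online_color_conj _ _ _ _ _ (near T)) => // [|t tT].
    exact: flipK.
  (* Since [s0] comes first in [sigma], all nodes presented up to [u] lie in the two chosen rows. *)
  apply: ball_near => //; apply/subsetP => v; rewrite inE.
  rewrite in_take // /sigma !index_cat !mem_enum u0; case: ifP => // _.
  have ltu : index u s0 < size s0 by rewrite index_mem mem_enum.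
  by rewrite ltnS leqNgt (leq_trans ltu) ?leq_addr.
have f_inj := inv_inj (flipK (2 * T + 3) : involutive f).
set g := online_color e T id sigma A in color_f.
set g' := online_color e T _ _ A in color_f.
have Pg u v : cyl_adj u v -> g u != g v.
  by move/sub_e; apply: solA.
have Pg' u v : cyl_adj u v -> g' u != g' v.
  move/sub_e; apply: solA.
  - exact: inj_comp.
  - by move=> w; exact: id_bound.
  - by rewrite map_inj_uniq.
  - by move=> w; rewrite -(flipK (2 * T + 3) w) (mem_map f_inj).
clearbody g g'.
have wg := winding_row r1 r2 Pg; have := winding_row r1 r2 Pg'.
have g'1 j : g' (r1, j) = g (r1, j).
  by rewrite -color_f ?inE /=; [rewrite /f /flip /= ifT; last lia | lia].
have g'2 j : g' (r2, j) = g (r2, rev_ord j).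
  rewrite -color_f ?inE /=; last lia.
  by rewrite /f /flip /= ifF ?rev_ordK; last lia.
have -> : winding (fun j => g' (r1, j)) = winding (fun j => g (r1, j)).
  by apply: eq_bigr => j _; rewrite !g'1.
have -> : winding (fun j => g' (r2, j))
          = winding ((fun j => g (r2, j)) \o @rev_ord m).
  by apply: eq_bigr => j _; rewrite !g'2.
(* The common winding number of the rows under [g] now equals its own opposite. *)
rewrite winding_rev -wg => w0.
have /eqP[] := winding_neq0 oddm (fun j => Pg _ _ (cyl_adj_ordS r1 j)).
by move: w0; lia.
Qed.

End Cylinder.

Theorem theorem2 :
  exists c : rat, (0 < c)%R /\ exists N : nat,
    forall (n m : nat), odd m -> n = m * m -> N <= n ->
    forall k : nat, 1 <= k ->
    forall (T : nat) (A : algo),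
      (solves_3col (@torus_adj m m) n k T A -> (c * m%:R <= T%:R)%R) /\
      (solves_3col (@cyl_adj m m) n k T A -> (c * m%:R <= T%:R)%R).
Proof.
(* The bound 100 gives m >= 10, and then 8T < m implies 4T+6 <= m. *)
exists (8%:R^-1)%R; split=> //; exists 100 => n m oddm -> leN k k_gt0 T A.
have m_ge10 : 10 <= m by nia.
suff bound (e : rel ('I_m * 'I_m)) : subrel (@cyl_adj m m) e ->
    (forall u v : 'I_m * 'I_m, 0 < u.1 < m.-1 -> e u v = cyl_adj u v) ->
    solves_3col e (m * m) k T A -> (8%:R^-1 * m%:R <= T%:R :> rat)%R.
  split; apply: bound => //.
    by move=> u v uv; rewrite /torus_adj uv.
  by move=> u v u_mid; rewrite /torus_adj; case: cyl_adj => //=; lia.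
move=> sub_e eE solA; rewrite mulrC ler_pdivrMr // -natrM ler_nat leqNgt.
apply/negP => ltT; have leTm : 4 * T + 6 <= m by lia.
by apply: (@cyl_like_locality m oddm _ e T k A) => //; lia.
Qed.
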